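(* Let $H$ be a residually finite dimensional Hopf algebra over a field $k$ which is either right or left Noetherian. Then its antipode $S:H\to H$ is bijective. Hence $H$ is right and left Noetherian simultaneously.
   Context: An algebra over $k$ is residually finite dimensional if its (two-sided) ideals of finite codimension have zero intersection. *)

(* Defs.v *)
From HB Require Import structures.
From mathcomp Require Import all_boot all_algebra.
From mathcomp Require Import finmap.
From mathcomp Require Import boolp classical_sets.
From mathcomp.multinomials Require Import monalg.

Set Implicit Arguments.
Unset Strict Implicit.
Unset Printing Implicit Defensive.

Import GRing.Theory.
Local Open Scope ring_scope.
Local Open Scope quotient_scope.

Reserved Notation "x \ox y" (at level 40, left associativity).

Fact tensor_key (n : nat) : unit. Proof. exact: tt. Qed.

Section TensorProduct.
Variables (k : fieldType) (U V : lmodType k).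

Local Notation free := {malg k[(U * V)%type]}.

(* The subspace of the free vector space on U * V spanned by the bilinearity
   relators. *)
Inductive tensor_rel : free -> Prop :=
| tensor_relDl a u u' v : tensor_rel
    (<< (a *: u + u', v) >> - (a *: << (u, v) >> + << (u', v) >>))
| tensor_relDr a u v v' : tensor_rel
    (<< (u, a *: v + v') >> - (a *: << (u, v) >> + << (u, v') >>))
| tensor_rel0 : tensor_rel 0
| tensor_relP a x y : tensor_rel x -> tensor_rel y -> tensor_rel (a *: x + y).

Definition tensor_null : pred free := fun x => `[< tensor_rel x >].

Lemma tensor_nullP x : reflect (tensor_rel x) (x \in tensor_null).
Proof. exact: asboolP. Qed.

Fact tensor_null_zmod_closed : zmod_closed tensor_null.
Proof.
split=> [|x y /tensor_nullP xN /tensor_nullP yN]; apply/tensor_nullP.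
  exact: tensor_rel0.
by rewrite addrC -scaleN1r; apply: tensor_relP.
Qed.
HB.instance Definition _ :=
  GRing.isZmodClosed.Build free tensor_null tensor_null_zmod_closed.

Local Notation quot := (Quotient.quot (GRing.ZmodClosed.clone free tensor_null _)).

(* A record, with operations locked under distinct keys, rather than an alias
   of the quotient: unification would otherwise unfold tensors. *)
Record tensor : Type := Tensor { tensor_val : quot }.
HB.instance Definition _ := [isNew for tensor_val].
HB.instance Definition _ := [Choice of tensor by <:].

Definition tensor_pi : free -> tensor :=
  locked_with (tensor_key 0) (fun x => Tensor (\pi_quot x)).
Canonical tensor_pi_unlockable := [unlockable fun tensor_pi].
Definition tensor_repr : tensor -> free :=
  locked_with (tensor_key 1) (fun t => repr (tensor_val t)).
Canonical tensor_repr_unlockable := [unlockable fun tensor_repr].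

Lemma tensor_pi_eqP x y : tensor_pi x = tensor_pi y <-> tensor_rel (x - y).
Proof.
rewrite unlock; split=> [[/eqP]|/tensor_nullP xyN].
  by rewrite -Quotient.idealrBE => /tensor_nullP.
by congr Tensor; apply/eqP; rewrite -Quotient.idealrBE.
Qed.

Lemma tensor_reprK t : tensor_pi (tensor_repr t) = t.
Proof. by case: t => t; rewrite unlock [tensor_repr]unlock /= reprK. Qed.

Lemma tensor_relD x y : tensor_rel x -> tensor_rel y -> tensor_rel (x + y).
Proof. by rewrite -{2}[x]scale1r; apply: tensor_relP. Qed.

Lemma tensor_relZ a x : tensor_rel x -> tensor_rel (a *: x).
Proof.
by rewrite -[a *: x]addr0 => xN; apply: tensor_relP xN _; apply: tensor_rel0.
Qed.

Definition tensor_add : tensor -> tensor -> tensor :=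
  locked_with (tensor_key 3)
    (fun s t => tensor_pi (tensor_repr s + tensor_repr t)).
Canonical tensor_add_unlockable := [unlockable fun tensor_add].
Definition tensor_opp : tensor -> tensor :=
  locked_with (tensor_key 4) (fun t => tensor_pi (- tensor_repr t)).
Canonical tensor_opp_unlockable := [unlockable fun tensor_opp].
Definition tensor_zero : tensor := locked_with (tensor_key 5) (tensor_pi 0).
Canonical tensor_zero_unlockable := [unlockable of tensor_zero].

Lemma tensor_piD x y : tensor_pi (x + y) = tensor_add (tensor_pi x) (tensor_pi y).
Proof.
rewrite [tensor_add]unlock; apply/tensor_pi_eqP; rewrite opprD addrACA.
by apply: tensor_relD; apply/tensor_pi_eqP; rewrite tensor_reprK.
Qed.

Lemma tensor_piN x : tensor_pi (- x) = tensor_opp (tensor_pi x).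
Proof.
rewrite [tensor_opp]unlock; apply/tensor_pi_eqP.
rewrite -opprD -scaleN1r; apply: tensor_relZ.
by apply/tensor_pi_eqP; rewrite tensor_reprK.
Qed.

Fact tensor_addA : associative tensor_add.
Proof.
move=> r s t; rewrite -(tensor_reprK r) -(tensor_reprK s) -(tensor_reprK t).
by rewrite -!tensor_piD addrA.
Qed.
Fact tensor_addC : commutative tensor_add.
Proof. by move=> s t; rewrite [tensor_add]unlock addrC. Qed.
Fact tensor_add0 : left_id tensor_zero tensor_add.
Proof. by move=> t; rewrite -(tensor_reprK t) [tensor_zero]unlock -tensor_piD add0r. Qed.
Fact tensor_addN : left_inverse tensor_zero tensor_opp tensor_add.
Proof.
by move=> t; rewrite -(tensor_reprK t) -tensor_piN -tensor_piD addNr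
  [tensor_zero]unlock.
Qed.
HB.instance Definition _ := GRing.isZmodule.Build tensor
  tensor_addA tensor_addC tensor_add0 tensor_addN.

Definition tensor_scale : k -> tensor -> tensor :=
  locked_with (tensor_key 6) (fun a t => tensor_pi (a *: tensor_repr t)).
Canonical tensor_scale_unlockable := [unlockable fun tensor_scale].

Lemma tensor_piZ a x : tensor_pi (a *: x) = tensor_scale a (tensor_pi x).
Proof.
rewrite [tensor_scale]unlock; apply/tensor_pi_eqP; rewrite -scalerBr.
apply: tensor_relZ.
by apply/tensor_pi_eqP; rewrite tensor_reprK.
Qed.

Fact tensor_scaleA a b t :
  tensor_scale a (tensor_scale b t) = tensor_scale (a * b) t.
Proof. by rewrite -(tensor_reprK t) -!tensor_piZ scalerA. Qed.
Fact tensor_scale1 : left_id 1 tensor_scale.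
Proof. by move=> t; rewrite -(tensor_reprK t) -!tensor_piZ scale1r. Qed.
Fact tensor_scaleDr : right_distributive tensor_scale +%R.
Proof.
move=> a t u; rewrite -(tensor_reprK t) -(tensor_reprK u).
by rewrite -[_ + _]tensor_piD -!tensor_piZ scalerDr tensor_piD.
Qed.
Fact tensor_scaleDl t : {morph tensor_scale^~ t : a b / a + b}.
Proof.
by move=> a b; rewrite -(tensor_reprK t) -!tensor_piZ scalerDl tensor_piD.
Qed.
HB.instance Definition _ := GRing.Zmodule_isLmodule.Build k tensor
  tensor_scaleA tensor_scale1 tensor_scaleDr tensor_scaleDl.

Fact tensor_pi_is_linear : linear tensor_pi.
Proof. by move=> a x y; rewrite tensor_piD tensor_piZ. Qed.
HB.instance Definition _ :=
  GRing.isLinear.Build k free tensor *:%R tensor_pi tensor_pi_is_linear.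

Definition tens : U -> V -> tensor :=
  locked_with (tensor_key 7) (fun u v => tensor_pi << (u, v) >>).
Canonical tens_unlockable := [unlockable fun tens].

Lemma tensE u v : tens u v = tensor_pi << (u, v) >>.
Proof. by rewrite [tens]unlock. Qed.

Fact tens_is_bilinear : bilinear_for *:%R *:%R tens.
Proof.
split=> [v a u u'|u a v v']; rewrite !tensE -linearP;
  apply/tensor_pi_eqP; [exact: tensor_relDl|exact: tensor_relDr].
Qed.
HB.instance Definition _ :=
  bilinear_isBilinear.Build k U V tensor *:%R *:%R tens tens_is_bilinear.

Lemma tensor_ind (P : tensor -> Prop) :
    P 0 -> (forall a u v t, P t -> P (a *: tens u v + t)) -> forall t, P t.
Proof.
move=> P0 PD t; rewrite -(tensor_reprK t) (monalgE (tensor_repr t)).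
elim: (X in \sum_(_ <- X) _ ) => [|[u v] s IHs].
  by rewrite big_nil linear0.
rewrite big_cons; set a := mcoeff _ _.
have -> : << a *g (u, v) >> = a *: << (u, v) >> :> free.
  by apply/malgP=> i; rewrite !mcoeffsE mulrnAr mulr1.
by rewrite linearP /= -tensE; apply: PD.
Qed.

Section Lift.
Variables (W : lmodType k) (f : {bilinear U -> V -> W}).

Definition free_lift (x : free) : W := \sum_(i <- msupp x) x@_i *: f i.1 i.2.

Lemma free_liftEw (x : free) (d : {fset (U * V)%type}) :
  (msupp x `<=` d)%fset -> free_lift x = \sum_(i <- d) x@_i *: f i.1 i.2.
Proof.
move=> xd; rewrite /free_lift (big_fset_incl _ xd) //= => i _ /mcoeff_outdom ->.
by rewrite scale0r.
Qed.

Fact free_lift_is_linear : linear free_lift.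
Proof.
move=> a x y; pose d := (msupp x `|` msupp y)%fset.
have xd : (msupp x `<=` d)%fset by exact: fsubsetUl.
have yd : (msupp y `<=` d)%fset by exact: fsubsetUr.
have axyd : (msupp (a *: x + y) `<=` d)%fset.
  apply: fsubset_trans (msuppD_le _ _) _; apply: fsetSU; exact: msuppZ_le.
rewrite (free_liftEw xd) (free_liftEw yd) (free_liftEw axyd) scaler_sumr.
rewrite -big_split /=; apply: eq_bigr => i _.
by rewrite mcoeffD mcoeffZ scalerDl scalerA.
Qed.
HB.instance Definition _ :=
  GRing.isLinear.Build k free W *:%R free_lift free_lift_is_linear.

Lemma free_liftU u v : free_lift << (u, v) >> = f u v.
Proof.
rewrite (@free_liftEw _ [fset (u, v)]%fset) ?msuppU_le //.
by rewrite big_seq_fset1 mcoeffUU scale1r.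
Qed.

Lemma free_lift_rel x : tensor_rel x -> free_lift x = 0.
Proof.
elim=> [a u u' v|a u v v'||a y z _ y0 _ z0].
- by rewrite linearB linearP /= !free_liftU linearPl subrr.
- by rewrite linearB linearP /= !free_liftU linearPr subrr.
- exact: linear0.
- by rewrite linearP /= y0 z0 scaler0 addr0.
Qed.

Definition tensor_lift : tensor -> W :=
  locked_with (tensor_key 2) (fun t => free_lift (tensor_repr t)).
Canonical tensor_lift_unlockable := [unlockable fun tensor_lift].

Lemma tensor_lift_pi x : tensor_lift (tensor_pi x) = free_lift x.
Proof.
rewrite unlock; apply/eqP; rewrite -subr_eq0 -linearB /=.
apply/eqP/free_lift_rel/tensor_pi_eqP.
exact: tensor_reprK.
Qed.

Fact tensor_lift_is_linear : linear tensor_lift.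
Proof.
move=> a t u; rewrite -(tensor_reprK t) -(tensor_reprK u) -linearP /=.
by rewrite !tensor_lift_pi linearP.
Qed.
HB.instance Definition _ :=
  GRing.isLinear.Build k tensor W *:%R tensor_lift tensor_lift_is_linear.

Lemma tensor_liftE u v : tensor_lift (tens u v) = f u v.
Proof. by rewrite tensE tensor_lift_pi free_liftU. Qed.

End Lift.

Lemma tensor_linear_ext (W : lmodType k) (f g : {linear tensor -> W}) :
  (forall u v, f (tens u v) = g (tens u v)) -> f =1 g.
Proof.
move=> fg; elim/tensor_ind => [|a u v t IHt]; first by rewrite !linear0.
by rewrite !linearP fg IHt.
Qed.

Lemma tensor_lift_linear (W : lmodType k) (f g h : {bilinear U -> V -> W}) a :
    (forall u v, f u v = a *: g u v + h u v) ->
  forall t, tensor_lift f t = a *: tensor_lift g t + tensor_lift h t.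
Proof.
move=> fgh; elim/tensor_ind => [|b u v t IHt].
  by rewrite !linear0 addr0.
rewrite !linearP /= IHt !tensor_liftE fgh !scalerDr !scalerA (mulrC b).
by rewrite addrACA.
Qed.

End TensorProduct.

Notation "x \ox y" := (tens x y) : ring_scope.

Section TensorMaps.
Variable k : fieldType.

Section Map.
Variables (U U' V V' : lmodType k).
Variables (f : {linear U -> U'}) (g : {linear V -> V'}).

Definition tens_map (u : U) (v : V) : tensor U' V' := f u \ox g v.
Fact tens_map_is_bilinear : bilinear_for *:%R *:%R tens_map.
Proof.
by split=> [v a u u'|u a v v']; rewrite /tens_map linearP ?linearPl ?linearPr.
Qed.
HB.instance Definition _ := bilinear_isBilinear.Build k U V (tensor U' V')
  *:%R *:%R tens_map tens_map_is_bilinear.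

Definition tensor_map : tensor U V -> tensor U' V' := tensor_lift tens_map.
HB.instance Definition _ := GRing.Linear.on tensor_map.

Lemma tensor_mapE u v : tensor_map (u \ox v) = f u \ox g v.
Proof. exact: tensor_liftE. Qed.

End Map.

Section Assoc.
Variables (U V W : lmodType k).

Definition tens_assoc1 (w : W) (u : U) (v : V) : tensor U (tensor V W) :=
  u \ox (v \ox w).
Fact tens_assoc1_is_bilinear w : bilinear_for *:%R *:%R (tens_assoc1 w).
Proof.
by split=> [v a u u'|u a v v']; rewrite /tens_assoc1 ?linearPl ?linearPr.
Qed.
HB.instance Definition _ w := bilinear_isBilinear.Build k U V
  (tensor U (tensor V W)) *:%R *:%R (tens_assoc1 w) (tens_assoc1_is_bilinear w).

Definition tens_assoc (t : tensor U V) (w : W) : tensor U (tensor V W) :=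
  tensor_lift (tens_assoc1 w) t.
Fact tens_assoc_is_bilinear : bilinear_for *:%R *:%R tens_assoc.
Proof.
split=> [w a t t'|t a w w']; first exact: linearP.
by apply: tensor_lift_linear => u v; rewrite /= /tens_assoc1 !linearPr.
Qed.
HB.instance Definition _ := bilinear_isBilinear.Build k (tensor U V) W
  (tensor U (tensor V W)) *:%R *:%R tens_assoc tens_assoc_is_bilinear.

Definition tensor_assoc : tensor (tensor U V) W -> tensor U (tensor V W) :=
  tensor_lift tens_assoc.
HB.instance Definition _ := GRing.Linear.on tensor_assoc.

Lemma tensor_assocE u v w :
  tensor_assoc (u \ox v \ox w) = u \ox (v \ox w).
Proof. by rewrite /tensor_assoc tensor_liftE; apply: tensor_liftE. Qed.

End Assoc.

Section Unitors.
Variable V : lmodType k.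

Definition tens_unitl (a : k^o) (v : V) : V := (a : k) *: v.
Fact tens_unitl_is_bilinear : bilinear_for *:%R *:%R tens_unitl.
Proof.
split=> [v a b c|b a v w]; rewrite /tens_unitl; last first.
  by rewrite scalerDr /= !scalerA mulrC.
by rewrite scalerDl /= scalerA.
Qed.
HB.instance Definition _ := bilinear_isBilinear.Build k k^o V V
  *:%R *:%R tens_unitl tens_unitl_is_bilinear.

Definition tensor_unitl : tensor k^o V -> V := tensor_lift tens_unitl.
HB.instance Definition _ := GRing.Linear.on tensor_unitl.

Lemma tensor_unitlE (a : k) v : tensor_unitl ((a : k^o) \ox v) = a *: v.
Proof. exact: tensor_liftE. Qed.

Definition tens_unitr (v : V) (a : k^o) : V := (a : k) *: v.
Fact tens_unitr_is_bilinear : bilinear_for *:%R *:%R tens_unitr.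
Proof.
by have [bl br] := tens_unitl_is_bilinear; split=> x; [apply: br|apply: bl].
Qed.
HB.instance Definition _ := bilinear_isBilinear.Build k V k^o V
  *:%R *:%R tens_unitr tens_unitr_is_bilinear.

Definition tensor_unitr : tensor V k^o -> V := tensor_lift tens_unitr.
HB.instance Definition _ := GRing.Linear.on tensor_unitr.

Lemma tensor_unitrE v (a : k) : tensor_unitr (v \ox (a : k^o)) = a *: v.
Proof. exact: tensor_liftE. Qed.

End Unitors.

Section MulMap.
Variable A : algType k.

Definition tens_mulmap (a b : A) : A := a * b.
Fact tens_mulmap_is_bilinear : bilinear_for *:%R *:%R tens_mulmap.
Proof.
split=> [c a u u'|u a v v']; rewrite /tens_mulmap.
  by rewrite mulrDl /= scalerAl.
by rewrite mulrDr /= scalerAr.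
Qed.
HB.instance Definition _ := bilinear_isBilinear.Build k A A A
  *:%R *:%R tens_mulmap tens_mulmap_is_bilinear.

Definition tensor_mulmap : tensor A A -> A := tensor_lift tens_mulmap.
HB.instance Definition _ := GRing.Linear.on tensor_mulmap.

Lemma tensor_mulmapE a b : tensor_mulmap (a \ox b) = a * b.
Proof. exact: tensor_liftE. Qed.

End MulMap.

End TensorMaps.

Section TensorAlgebra.
Variables (k : fieldType) (A B : algType k).
Local Notation AB := (tensor A B).

Definition tens_mul1 (a : A) (b : B) (a' : A) (b' : B) : AB :=
  (a * a') \ox (b * b').
Fact tens_mul1_is_bilinear a b : bilinear_for *:%R *:%R (tens_mul1 a b).
Proof.
split=> [v c u u'|u c v v']; rewrite /tens_mul1 mulrDr -scalerAr.
  exact: linearPl.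
exact: linearPr.
Qed.
HB.instance Definition _ a b := bilinear_isBilinear.Build k A B AB
  *:%R *:%R (tens_mul1 a b) (tens_mul1_is_bilinear a b).

Definition tens_mul2 (t : AB) (a : A) (b : B) : AB :=
  tensor_lift (tens_mul1 a b) t.
Fact tens_mul2_is_bilinear t : bilinear_for *:%R *:%R (tens_mul2 t).
Proof.
split=> [v c u u'|u c v v']; apply: tensor_lift_linear => a b.
  by rewrite /= /tens_mul1 mulrDl -scalerAl linearPl.
by rewrite /= /tens_mul1 mulrDl -scalerAl linearPr.
Qed.
HB.instance Definition _ t := bilinear_isBilinear.Build k A B AB
  *:%R *:%R (tens_mul2 t) (tens_mul2_is_bilinear t).

Definition tensor_mul : AB -> AB -> AB :=
  locked_with (tensor_key 8) (fun s t => tensor_lift (tens_mul2 t) s).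
Canonical tensor_mul_unlockable := [unlockable fun tensor_mul].
Definition tensor_one : AB := 1 \ox 1.

Lemma tensor_mul_tens a b a' b' :
  tensor_mul (a \ox b) (a' \ox b') = (a * a') \ox (b * b').
Proof. by rewrite [tensor_mul]unlock tensor_liftE; apply: tensor_liftE. Qed.

Fact tensor_mulPl t a s s' :
  tensor_mul (a *: s + s') t = a *: tensor_mul s t + tensor_mul s' t.
Proof. by rewrite [tensor_mul]unlock; apply: linearP. Qed.
Fact tensor_mulPr s a t t' :
  tensor_mul s (a *: t + t') = a *: tensor_mul s t + tensor_mul s t'.
Proof.
by rewrite [tensor_mul]unlock; apply: tensor_lift_linear => x y; apply: linearP.
Qed.

Fact tensor_mul0l t : tensor_mul 0 t = 0.
Proof. by rewrite [tensor_mul]unlock; apply: linear0. Qed.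
Fact tensor_mul0r s : tensor_mul s 0 = 0.
Proof.
by rewrite -[X in tensor_mul s X](addNr 0) -scaleN1r tensor_mulPr scaleN1r addNr.
Qed.

Fact tensor_mulA : associative tensor_mul.
Proof.
elim/tensor_ind=> [|c a b r IHr] s t; first by rewrite !tensor_mul0l.
rewrite !tensor_mulPl -IHr; congr (_ *: _ + _); elim/tensor_ind: s
  => [|d a' b' s IHs]; first by rewrite !(tensor_mul0l, tensor_mul0r).
rewrite tensor_mulPl !tensor_mulPr tensor_mulPl IHs; congr (_ *: _ + _).
elim/tensor_ind: t {IHs} => [|e a'' b'' t IHt]; first by rewrite !tensor_mul0r.
by rewrite !tensor_mulPr IHt !tensor_mul_tens !mulrA.
Qed.
Fact tensor_mul1l : left_id tensor_one tensor_mul.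
Proof.
elim/tensor_ind=> [|c a b t IHt]; first exact: tensor_mul0r.
by rewrite tensor_mulPr IHt tensor_mul_tens !mul1r.
Qed.
Fact tensor_mul1r : right_id tensor_one tensor_mul.
Proof.
elim/tensor_ind=> [|c a b t IHt]; first exact: tensor_mul0l.
by rewrite tensor_mulPl IHt tensor_mul_tens !mulr1.
Qed.
Fact tensor_mulDl : left_distributive tensor_mul +%R.
Proof. by move=> r s t; have := tensor_mulPl t 1 r s; rewrite !scale1r. Qed.
Fact tensor_mulDr : right_distributive tensor_mul +%R.
Proof. by move=> r s t; have := tensor_mulPr r 1 s t; rewrite !scale1r. Qed.
(* Only a potentially zero ring: that 1 \ox 1 is nonzero, which algType would
   require, plays no role in the axioms of a bialgebra. *)
HB.instance Definition _ := GRing.Zmodule_isPzRing.Build AB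
  tensor_mulA tensor_mul1l tensor_mul1r tensor_mulDl tensor_mulDr.

Lemma tensor_oneE : 1 = 1 \ox 1 :> AB.
Proof. by []. Qed.

Lemma tensor_mulE a b a' b' :
  (a \ox b) * (a' \ox b') = (a * a') \ox (b * b') :> AB.
Proof. exact: tensor_mul_tens. Qed.

End TensorAlgebra.

HB.mixin Record isCoalgebra (k : fieldType) C of GRing.Lmodule k C := {
  comul : {linear C -> tensor C C};
  counit : {linear C -> k^o};
  comulA : forall c,
    tensor_assoc (tensor_map comul idfun (comul c))
    = tensor_map idfun comul (comul c);
  counitl : forall c, tensor_unitl (tensor_map counit idfun (comul c)) = c;
  counitr : forall c, tensor_unitr (tensor_map idfun counit (comul c)) = c
}.

#[short(type="coalgType")]
HB.structure Definition Coalgebra (k : fieldType) :=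
  {C of GRing.Lmodule k C & isCoalgebra k C}.

HB.mixin Record isBialgebra (k : fieldType) B
    of GRing.Algebra k B & Coalgebra k B := {
  comul_monoid_morphism : monoid_morphism (@comul k B);
  counit_monoid_morphism : monoid_morphism (@counit k B)
}.

#[short(type="bialgType")]
HB.structure Definition Bialgebra (k : fieldType) :=
  {B of GRing.Algebra k B & Coalgebra k B & isBialgebra k B}.

HB.mixin Record isHopfAlgebra (k : fieldType) H of Bialgebra k H := {
  antipode : {linear H -> H};
  antipodel : forall h,
    tensor_mulmap (tensor_map antipode idfun (comul h)) = (counit h : k)%:A;
  antipoder : forall h,
    tensor_mulmap (tensor_map idfun antipode (comul h)) = (counit h : k)%:A
}.

#[short(type="hopfAlgType")]
HB.structure Definition HopfAlgebra (k : fieldType) :=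
  {H of Bialgebra k H & isHopfAlgebra k H}.

Section Ideals.
Local Open Scope classical_set_scope.

Definition left_ideal (A : pzRingType) (I : set A) : Prop :=
  [/\ I 0, forall x y, I x -> I y -> I (x + y) & forall a x, I x -> I (a * x)].

Definition right_ideal (A : pzRingType) (I : set A) : Prop :=
  [/\ I 0, forall x y, I x -> I y -> I (x + y) & forall a x, I x -> I (x * a)].

Definition ideal (A : pzRingType) (I : set A) : Prop :=
  left_ideal I /\ right_ideal I.

Definition acc (T : Type) (P : set T -> Prop) : Prop :=
  forall I : nat -> set T, (forall n, P (I n)) ->
    (forall n, I n `<=` I n.+1) ->
  exists N, forall n, (N <= n)%N -> I n = I N.

Definition left_noetherian (A : pzRingType) : Prop := acc (@left_ideal A).
Definition right_noetherian (A : pzRingType) : Prop := acc (@right_ideal A).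

(* The classes of finitely many vectors b i span the quotient V / I. *)
Definition finite_codim (k : fieldType) (V : lmodType k) (I : set V) : Prop :=
  exists n (b : 'I_n -> V), forall x,
    exists c : 'I_n -> k, I (x - \sum_(i < n) c i *: b i).

Definition residually_finite_dim (k : fieldType) (A : algType k) : Prop :=
  \bigcap_(I in [set I : set A | ideal I /\ finite_codim I]) I = [set 0].

End Ideals.

(* Main.v *)
Require Import Defs.
From HB Require Import structures.
From mathcomp Require Import all_boot all_algebra.
From mathcomp Require Import boolp classical_sets.

(** The antipode [S] reverses both products and coproducts, so the statement
    only has to be proved for right Noetherian [H]: a left Noetherian [H] is
    handled through the Hopf algebra with opposite product and opposite
    coproduct, which has the same antipode.

    Everything takes place in right [H]-submodules of [W (x) H], where [W] is a
    coideal of finite dimension and [H] acts on the right factor. Such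
    submodules satisfy the ascending chain condition ([acc_rspan]).

    Injectivity ([antipode_inj]). The map [a (x) h |-> a1 (x) S(a2) h] is
    invertible on [W (x) H], and it preserves the kernel [P] of [S (x) id]. In a
    Noetherian module an automorphism which maps a submodule into itself maps
    it onto itself, so the inverse [a (x) h |-> a1 (x) a2 h] also preserves [P].
    If [S x = 0] then [x (x) 1] is in [P], hence so is [x1 (x) x2], that is
    [S x1 (x) x2 = 0]; the counit turns this into [x = 0].

    Surjectivity ([antipode_surj]). Given [c], it is enough to have [S c] in
    [S^2 H]. The elements [s] with [S(c) S^2(s)] in [S^2 H], the denominators of
    [c], form a right ideal. Two facts about them are combined.

    - This right ideal is essential ([denominator_essential]): the map
      [a (x) h |-> a2 (x) a1 h] is injective because [S] is, an injective
      endomorphism of a Noetherian module has an essential image, and an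
      element [c (x) s] of the image has [s] as a denominator of [c]. So any
      finite set of elements has a common nonzero denominator.

    - The common denominators of a finite-dimensional left coideal [W] are
      stable under the translations [s |-> s1 g(S^2 s2)], for every functional
      [g] ([denominator_slice]), by the identity
      [S(w) S^2(s1) (x) S^2(s2) = (1 (x) w1) Delta(S(w2) S^2(s))].

    Translating a nonzero common denominator gives one, [s], with
    [epsilon(s) = 1]. All its translates are common denominators too, hence so
    is [1 = s1 S(s2)], and this says that [S w] is in [S^2 H] for [w] in [W].

    Once [S] is a bijective anti-automorphism, taking preimages under [S]
    exchanges left and right ideals and transports the chain condition. *)

Set Implicit Arguments.
Unset Strict Implicit.
Unset Printing Implicit Defensive.

Import GRing.Theory.
Local Open Scope ring_scope.
Local Open Scope classical_set_scope.

(** * Multilinear maps *)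

Section Multilinear.
Variable k : fieldType.

(** Unbundled, so that bilinearity of an anonymous function can be left to the
    tactic [multilin] below instead of being declared as an instance. *)
Definition bilin (U V W : lmodType k) (f : U -> V -> W) : Prop :=
  (forall a u u' v, f (a *: u + u') v = a *: f u v + f u' v)
  /\ (forall a u v v', f u (a *: v + v') = a *: f u v + f u v').

Definition trilin (U V W X : lmodType k) (f : U -> V -> W -> X) : Prop :=
  (forall w, bilin (fun u v => f u v w)) /\ (forall u, bilin (f u)).

Lemma linear_pack (U V : lmodType k) (f : U -> V) :
  linear f -> exists g : {linear U -> V}, g =1 f.
Proof.
move=> f_lin; pose b := GRing.isLinear.Build k U V *:%R f f_lin.
by pose F : {linear U -> V} := HB.pack f b; exists F.
Qed.

Lemma iter_linear0 (V : lmodType k) (f : {linear V -> V}) m :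
  iter m f 0 = 0.
Proof. by elim: m => //= m ->; rewrite linear0. Qed.

Lemma iter_linearD (V : lmodType k) (f : {linear V -> V}) m x y :
  iter m f (x + y) = iter m f x + iter m f y.
Proof. by elim: m => //= m ->; rewrite linearD. Qed.

Lemma tensor_lift_exists (U V W : lmodType k) (f : U -> V -> W) : bilin f ->
  exists g : {linear tensor U V -> W}, forall u v, g (u \ox v) = f u v.
Proof.
move=> [fl fr].
have f_bilin : bilinear_for *:%R *:%R f.
  by split=> [v a u u'|u a v v']; [apply: fl|apply: fr].
pose b := bilinear_isBilinear.Build k U V W *:%R *:%R f f_bilin.
pose F : {bilinear U -> V -> W} := HB.pack f b.
by exists (tensor_lift F) => u v; rewrite /= tensor_liftE.
Qed.

Lemma tensor_expand (U V : lmodType k) (t : tensor U V) :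
  exists s : seq (U * V), t = \sum_(p <- s) p.1 \ox p.2.
Proof.
elim/tensor_ind: t => [|a u v _ [s ->]]; first by exists [::]; rewrite big_nil.
by exists ((a *: u, v) :: s); rewrite big_cons linearZl_LR.
Qed.

Variables (U V W : lmodType k) (A : algType k) (a : k).

Lemma tens0r (u : U) : u \ox (0 : V) = 0.
Proof. exact: linear0r. Qed.

(** The lemmas [lin_*] push one linear combination out of one operation; they
    are stated as implications so that they chain backwards. *)
Lemma lin_tensl (u u' u'' : U) (v : V) : u = a *: u' + u'' ->
  u \ox v = a *: (u' \ox v) + u'' \ox v.
Proof. by move=> ->; apply: linearPl. Qed.
Lemma lin_tensr (u : U) (v v' v'' : V) : v = a *: v' + v'' ->
  u \ox v = a *: (u \ox v') + u \ox v''.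
Proof. by move=> ->; apply: linearPr. Qed.
Lemma lin_mull (x y z w : A) : x = a *: y + z -> x * w = a *: (y * w) + z * w.
Proof. by move=> ->; rewrite mulrDl scalerAl. Qed.
Lemma lin_mulr (x y z w : A) : x = a *: y + z -> w * x = a *: (w * y) + w * z.
Proof. by move=> ->; rewrite mulrDr scalerAr. Qed.
Lemma lin_tmull (x y z w : tensor A A) :
  x = a *: y + z -> x * w = a *: (y * w) + z * w.
Proof. by move=> ->; apply: tensor_mulPl. Qed.
Lemma lin_tmulr (x y z w : tensor A A) :
  x = a *: y + z -> w * x = a *: (w * y) + w * z.
Proof. by move=> ->; apply: tensor_mulPr. Qed.
Lemma lin_app (f : {linear U -> V}) (x y z : U) :
  x = a *: y + z -> f x = a *: f y + f z.
Proof. by move=> ->; apply: linearP. Qed.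
Lemma lin_scalel (f : {linear U -> k^o}) (x y z : U) (v : V) :
  x = a *: y + z -> (f x : k) *: v = a *: ((f y : k) *: v) + (f z : k) *: v.
Proof. by move=> ->; rewrite linearP /= scalerDl scalerA. Qed.
Lemma lin_scaler (c : k) (x y z : V) :
  x = a *: y + z -> c *: x = a *: (c *: y) + c *: z.
Proof. by move=> ->; rewrite scalerDr !scalerA mulrC. Qed.
End Multilinear.

(** * Sweedler sums *)

Section Sweedler.
Variables (k : fieldType) (C : coalgType k).

(** The expansion of [comul x] is chosen once and for all, but only sums of
    bilinear terms over it are meaningful; for these the choice is immaterial
    by [lift_cop]. *)
Definition sw (x : C) : seq (C * C) := sval (cid (tensor_expand (comul x))).

Definition cop (W : nmodType) (x : C) (f : C -> C -> W) : W :=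
  \sum_(p <- sw x) f p.1 p.2.

End Sweedler.

Notation "\cop_ ( x => a , b ) E" := (cop x (fun a b => E))
  (at level 36, E at level 36, x at level 50, a name, b name,
   format "\cop_ ( x  =>  a ,  b )  E") : ring_scope.

Section SweedlerTheory.
Variables (k : fieldType) (C : coalgType k).
Implicit Types (x y : C) (W : lmodType k).

Lemma comul_cop x : comul x = \cop_(x => a, b) (a \ox b).
Proof. exact: (svalP (cid (tensor_expand (comul x)))). Qed.

Lemma eq_cop (W : nmodType) x (f g : C -> C -> W) :
  (forall a b, f a b = g a b) -> cop x f = cop x g.
Proof. by move=> fg; apply: eq_bigr. Qed.

Lemma lift_cop W (f : C -> C -> W) (g : {linear tensor C C -> W}) :
  (forall a b, g (a \ox b) = f a b) -> forall x, g (comul x) = cop x f.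
Proof. by move=> gE x; rewrite comul_cop linear_sum; apply: eq_bigr. Qed.

Lemma linear_cop W W' (g : {linear W -> W'}) (f : C -> C -> W) x :
  g (cop x f) = \cop_(x => a, b) g (f a b).
Proof. exact: linear_sum. Qed.

Lemma tens_copr (U W : lmodType k) (u : U) (f : C -> C -> W) x :
  u \ox cop x f = \cop_(x => a, b) (u \ox f a b).
Proof. exact: linear_sumr. Qed.

Lemma tens_copl (U W : lmodType k) (u : U) (f : C -> C -> W) x :
  cop x f \ox u = \cop_(x => a, b) (f a b \ox u).
Proof. exact: linear_sumlz. Qed.

Lemma cop_linear W (f : C -> C -> W) : bilin f -> linear (fun x => cop x f).
Proof.
move=> /tensor_lift_exists[g gE] a x y.
by rewrite -!(lift_cop gE) !linearP.
Qed.

Lemma cop_paramP W x a (f g : C -> C -> W) :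
  \cop_(x => b, c) (a *: f b c + g b c) = a *: cop x f + cop x g.
Proof. by rewrite /cop scaler_sumr big_split. Qed.

Lemma lin_cop W x a (f g h : C -> C -> W) :
  (forall b c, f b c = a *: g b c + h b c) ->
  cop x f = a *: cop x g + cop x h.
Proof. by move=> fE; rewrite -cop_paramP; apply: eq_cop. Qed.

Lemma lin_cop_arg W (f : C -> C -> W) a x y z : bilin f -> x = a *: y + z ->
  cop x f = a *: cop y f + cop z f.
Proof. by move=> f_bilin ->; apply: cop_linear. Qed.

Lemma cop_mulr (R : pzRingType) (x : C) (z : R) (f : C -> C -> R) :
  cop x f * z = \cop_(x => a, b) (f a b * z).
Proof. exact: mulr_suml. Qed.
Lemma cop_mull (R : pzRingType) (x : C) (z : R) (f : C -> C -> R) :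
  z * cop x f = \cop_(x => a, b) (z * f a b).
Proof. exact: mulr_sumr. Qed.
Lemma cop_scale (W : lmodType k) (x : C) (c : k) (f : C -> C -> W) :
  c *: cop x f = \cop_(x => a, b) (c *: f a b).
Proof. exact: scaler_sumr. Qed.

Lemma exchange_cop W x y (f : C -> C -> C -> C -> W) :
  \cop_(x => a, b) \cop_(y => c, d) f a b c d
  = \cop_(y => c, d) \cop_(x => a, b) f a b c d.
Proof. exact: exchange_big. Qed.

Lemma copA W x (f : C -> C -> C -> W) : trilin f ->
  \cop_(x => a, b) \cop_(a => c, d) f c d b
  = \cop_(x => a, b) \cop_(b => c, d) f a c d.
Proof.
move=> [f12 f23].
have := fun a => cid (tensor_lift_exists (f23 a)) => /all_sig[g gE].
have gbilin : bilin (fun a t => g a t).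
  split=> [c a a' t|c a t t']; last exact: linearP.
  elim/tensor_ind: t => [|d u v t IH].
    by rewrite !linear0 ?addr0.
  rewrite !linearP IH !gE (f12 v).1 !scalerDr !scalerA (mulrC d).
  by rewrite addrACA.
(* [h] is the linear map on the triple tensor product induced by [f]. *)
have [h hE] := tensor_lift_exists gbilin.
have := congr1 h (comulA x); rewrite !comul_cop !linear_sum /=.
set l := (X in X = _); set r := (X in _ = X) => lr.
transitivity l.
  rewrite /l; apply: eq_bigr => p _.
  rewrite tensor_mapE /= comul_cop linear_sumlz !linear_sum /=.
  by apply: eq_bigr => q _; rewrite tensor_assocE hE gE.
rewrite lr; apply: eq_bigr => p _.
by rewrite tensor_mapE /= hE; apply: (@lift_cop _ (f p.1)) => a b; apply: gE.
Qed.

Lemma cop_counitl W (f : C -> W) x : linear f ->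
  \cop_(x => a, b) ((counit a : k) *: f b) = f x.
Proof.
move=> /linear_pack[g gE]; rewrite -gE -{2}[x]counitl comul_cop !linear_sum /=.
by apply: eq_bigr => p _; rewrite /= tensor_mapE tensor_unitlE linearZ gE.
Qed.

Lemma cop_counitr W (f : C -> W) x : linear f ->
  \cop_(x => a, b) ((counit b : k) *: f a) = f x.
Proof.
move=> /linear_pack[g gE]; rewrite -gE -{2}[x]counitr comul_cop !linear_sum /=.
by apply: eq_bigr => p _; rewrite /= tensor_mapE tensor_unitrE linearZ gE.
Qed.

End SweedlerTheory.

(** Proves [bilin], [trilin] and [linear] goals by following the syntax of the
    term: at each step the operand that differs between the two sides is the
    one that carries the variable. *)
Ltac multilin := intros; cbv beta; first
  [ reflexivity
  | match goal with
    | |- bilin _ => split; multilin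
    | |- trilin _ => split; multilin
    | |- linear _ => move=> ? ? ?; multilin
    | |- cop ?x _ = _ *: cop ?x _ + cop ?x _ => apply: lin_cop; multilin
    | |- cop _ _ = _ *: cop _ _ + cop _ _ => apply: lin_cop_arg; multilin
    | |- _ * ?w = _ *: (_ * ?w) + _ * ?w =>
        first [apply: lin_mull | apply: lin_tmull]; multilin
    | |- ?w * _ = _ *: (?w * _) + ?w * _ =>
        first [apply: lin_mulr | apply: lin_tmulr]; multilin
    | |- _ \ox ?w = _ *: (_ \ox ?w) + _ \ox ?w => apply: lin_tensl; multilin
    | |- ?w \ox _ = _ *: (?w \ox _) + ?w \ox _ => apply: lin_tensr; multilin
    | |- ?c *: _ = _ *: (?c *: _) + ?c *: _ => apply: lin_scaler; multilin
    | |- _ *: ?v = _ *: (_ *: ?v) + _ *: ?v => apply: lin_scalel; multilin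
    | |- _ => apply: lin_app; multilin
    end ].

(** * The antipode reverses products and coproducts *)

Section Antipode.
Variables (k : fieldType) (H : hopfAlgType k).
Implicit Types x y z : H.
Local Notation S := (@antipode k H).
Local Notation eps x := (@counit k H x : k).

Lemma comulM x y : comul (x * y) = comul x * comul y.
Proof. exact: (@comul_monoid_morphism k H).2. Qed.
Lemma comul1 : comul (1 : H) = 1 \ox 1.
Proof. exact: (@comul_monoid_morphism k H).1. Qed.
Lemma epsM x y : eps (x * y) = eps x * eps y.
Proof. exact: (@counit_monoid_morphism k H).2. Qed.
Lemma eps1 : eps 1 = 1.
Proof. exact: (@counit_monoid_morphism k H).1. Qed.

Lemma cop_antipodel x : \cop_(x => a, b) (S a * b) = eps x *: 1.
Proof.
rewrite -[RHS]antipodel comul_cop !linear_sum; apply: eq_bigr => p _.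
by rewrite /= tensor_mapE tensor_mulmapE.
Qed.

Lemma cop_antipoder x : \cop_(x => a, b) (a * S b) = eps x *: 1.
Proof.
rewrite -[RHS]antipoder comul_cop !linear_sum; apply: eq_bigr => p _.
by rewrite /= tensor_mapE tensor_mulmapE.
Qed.

Lemma cop_mul (W : lmodType k) (f : H -> H -> W) x y : bilin f ->
  cop (x * y) f = \cop_(x => a, b) \cop_(y => c, d) f (a * c) (b * d).
Proof.
move=> /tensor_lift_exists[g gE].
rewrite -(lift_cop gE) comulM !comul_cop cop_mulr linear_cop.
apply: eq_cop => a b; rewrite cop_mull linear_cop.
by apply: eq_cop => c d; rewrite tensor_mulE gE.
Qed.

Lemma cop1 (W : lmodType k) (f : H -> H -> W) : bilin f -> cop 1 f = f 1 1.
Proof.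
by move=> /tensor_lift_exists[g gE]; rewrite -(lift_cop gE) comul1 gE.
Qed.

Lemma antipode1 : S 1 = 1.
Proof.
have := cop_antipodel 1; rewrite cop1 ?mulr1 => [->|]; last by multilin.
by rewrite eps1 scale1r.
Qed.

(** Both sides are convolution inverses of the product: each is compared with
    [S(x1 y1) x2 y2 S(y3) S(x3)]. *)
Lemma antipodeM x y : S (x * y) = S y * S x.
Proof.
pose G a e g := \cop_(a => c, d) (S (c * e) * (d * g)).
have e1 a : \cop_(a => c, d) (S (c * y) * d) = eps a *: S y.
  transitivity (\cop_(y => e, f) \cop_(e => g, h) (G a g h * S f)); last first.
    rewrite -[RHS](@cop_counitl _ _ _ (fun y => eps a *: S y));
      last by multilin.
    apply: eq_cop => e f; rewrite -cop_mulr /G -exchange_cop.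
    rewrite -(@cop_mul _ (fun u v => S u * v)); last by multilin.
    by rewrite cop_antipodel epsM -scalerAl mul1r scalerA mulrC.
  rewrite (@copA _ _ _ _ (fun g h f => G a g h * S f));
    last by rewrite /G; multilin.
  rewrite -[LHS](@cop_counitr _ _ _
    (fun y => \cop_(a => c, d) (S (c * y) * d))); last by multilin.
  apply: eq_cop => e f; rewrite cop_scale [in RHS]/G.
  under [RHS]eq_cop => g h do rewrite cop_mulr.
  rewrite -exchange_cop; apply: eq_cop => c d.
  under [RHS]eq_cop => g h do rewrite -!mulrA.
  by rewrite -!cop_mull cop_antipoder -!scalerAr mulr1.
transitivity (\cop_(x => a, b) \cop_(a => c, d) (S (c * y) * d * S b)).
  rewrite (@copA _ _ _ _ (fun c d b => S (c * y) * d * S b)); last by multilin.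
  rewrite -[LHS](@cop_counitr _ _ _ (fun x => S (x * y))); last by multilin.
  apply: eq_cop => a b; under [RHS]eq_cop => c d do rewrite -mulrA.
  by rewrite -cop_mull cop_antipoder -scalerAr mulr1.
under eq_cop => a b do rewrite -cop_mulr e1 -scalerAl.
by rewrite (@cop_counitl _ _ _ (fun x => S y * S x)) //; multilin.
Qed.

(** Both sides are convolution inverses of [comul]: [comul (S x)] on the left
    because [comul] is multiplicative, [S x2 (x) S x1] on the right by [DQ]. *)
Lemma comul_antipode x : comul (S x) = \cop_(x => a, b) (S b \ox S a).
Proof.
pose Q x := \cop_(x => a, b) (S b \ox S a).
have DQ z : \cop_(z => a, b) (comul a * Q b) = eps z *: (1 \ox 1).
  pose F a c b : tensor H H := \cop_(b => e, f) ((a * S f) \ox (c * S e)).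
  transitivity (\cop_(z => a, b) \cop_(a => c, d) F c d b).
    apply: eq_cop => a b; rewrite comul_cop cop_mulr; apply: eq_cop => c d.
    by rewrite /Q cop_mull; apply: eq_cop => e f; rewrite tensor_mulE.
  rewrite copA; last by rewrite /F; multilin.
  transitivity (\cop_(z => a, b) ((a * S b) \ox (1 : H))).
    apply: eq_cop => a b.
    rewrite -(@copA _ _ _ _ (fun c e f => (a * S f) \ox (c * S e)));
      last by multilin.
    rewrite -[RHS](@cop_counitl _ _ _ (fun b => (a * S b) \ox (1 : H)));
      last by multilin.
    apply: eq_cop => c d; rewrite -tens_copr cop_antipoder.
    by rewrite linearZr_LR.
  by rewrite -tens_copl cop_antipoder linearZl_LR.
transitivity (\cop_(x => a, b) \cop_(a => c, d) (comul (S c) * comul d * Q b)).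
  rewrite (@copA _ _ _ _ (fun c d b => comul (S c) * comul d * Q b));
    last by rewrite /Q; multilin.
  rewrite -[LHS](@cop_counitr _ _ _ (fun x => comul (S x))); last by multilin.
  apply: eq_cop => a b; under [RHS]eq_cop => c d do rewrite -mulrA.
  rewrite -cop_mull DQ.
  by have := @lin_tmulr _ _ (eps b) _ (1 \ox 1) 0 (comul (S a)) (erefl _);
    rewrite addr0 mulr0 addr0 mulr1 => ->.
transitivity (\cop_(x => a, b) (eps a *: Q b)).
  apply: eq_cop => a b; rewrite -cop_mulr.
  under eq_cop => c d do rewrite -comulM.
  rewrite -linear_cop cop_antipodel linearZ_LR comul1 /=.
  by have := @lin_tmull _ _ (eps a) _ (1 \ox 1) 0 (Q b) (erefl _);
    rewrite addr0 mul0r addr0 mul1r => ->.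
by rewrite cop_counitl //; rewrite /Q; multilin.
Qed.
End Antipode.

(** * Functionals and biorthogonal decompositions *)

Section Functionals.
Variable k : fieldType.

(** A subspace which is maximal among those that avoid [u] is a complement of
    the line through [u]; [g] reads off the coordinate on that line. *)
Lemma functional_exists (V : lmodType k) (u : V) :
  u != 0 -> exists g : {linear V -> k^o}, g u = 1 :> k.
Proof.
move=> u0.
pose P := [set M : set V |
  (forall a x y, M x -> M y -> M (a *: x + y)) /\ ~ M u].
have [|M [[Mlin Mu] Mmax]] := @Zorn_bigcup V P.
  move=> F FP Ftot; split=> [a x y [X FX Xx] [Y FY Yy]|[X FX /(FP X FX).2//]].
  have [XY|YX] := Ftot X Y FX FY.
    by exists Y => //; apply: (FP Y FY).1 => //; apply: XY.
  by exists X => //; apply: (FP X FX).1 => //; apply: YX.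
(* The empty set belongs to [P], which makes the empty chain harmless; a
   maximal member is nonetheless nonempty, because [[set 0]] belongs to [P]. *)
have M0 : M 0.
  apply: contrapT => nM0; apply: (Mmax [set 0]).
    split=> [x Mx|/(_ 0 erefl)//]; exfalso; apply: nM0.
    by rewrite -(addNr x) -scaleN1r; apply: Mlin.
  split=> [a x y -> ->|/eqP]; first by rewrite scaler0 addr0.
  by rewrite (negPf u0).
have MZ a x : M x -> M (a *: x).
  by move=> Mx; rewrite -[_ *: _]addr0; apply: Mlin.
have MD x y : M x -> M y -> M (x + y).
  by move=> Mx My; rewrite -[x]scale1r; apply: Mlin.
have dec x : exists a, M (x - a *: u).
  have [Mx|nMx] := pselect (M x); first by exists 0; rewrite scale0r subr0.
  pose B := [set y | exists a, M (y - a *: x)].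
  have : B u.
    apply: contrapT => nBu; apply: (Mmax B); split=> //.
    - by move=> y My; exists 0; rewrite scale0r subr0.
    - by move=> /(_ x) BM; apply/nMx/BM; exists 1; rewrite scale1r subrr.
    - move=> a y z [b My] [c Mz]; exists (a * b + c).
      have := Mlin a _ _ My Mz; congr M.
      by rewrite scalerDl opprD addrACA scalerBr scalerA.
  move=> [a Ma]; have a0 : a != 0.
    by apply: contra_not_neq Mu => a0; move: Ma; rewrite a0 scale0r subr0.
  exists a^-1; have := MZ (- a^-1) _ Ma; congr M.
  by rewrite scalerBr !scaleNr scalerA mulVf // scale1r opprK addrC.
have uniq x a b : M (x - a *: u) -> M (x - b *: u) -> a = b.
  move=> Ma Mb; apply: contrapT => ab; apply: Mu.
  have ab0 : a - b != 0 by rewrite subr_eq0; apply/eqP.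
  have := MZ (a - b)^-1 _ (MD _ _ Mb (MZ (-1) _ Ma)); congr M.
  rewrite scaleN1r opprB [X in _ *: X]addrC addrA subrK -scalerBl scalerA.
  by rewrite mulVf // scale1r.
have [f fM] : {f : V -> k^o & forall x, M (x - (f x : k) *: u)}.
  by exists (fun x => sval (cid (dec x))) => x; apply: (svalP (cid (dec x))).
have [|g gE] := @linear_pack k V k^o f.
  move=> a x y; apply: uniq (fM _) _.
  have := Mlin a _ _ (fM x) (fM y); congr M.
  by rewrite /= scalerDl opprD addrACA scalerBr scalerA.
exists g; rewrite gE; apply: uniq (fM u) _.
by rewrite scale1r subrr.
Qed.

(** Terms are added one at a time: the new right factor is first reduced
    modulo the previous ones, and is dropped if nothing is left of it.
    Functionals dual to the images under [phi], rather than to the [b j]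
    themselves, spare the extension of functionals along [phi]. *)
Lemma tensor_biorthogonal (U V W : lmodType k) (phi : {linear V -> W})
    (t : tensor U V) : injective phi ->
  exists n (a : nat -> U) (b : nat -> V) (g : nat -> {linear W -> k^o}),
    t = \sum_(i < n) a i \ox b i
    /\ forall i j, (i < n)%N -> (j < n)%N -> g i (phi (b j)) = (i == j)%:R :> k.
Proof.
move=> phi_inj; elim/tensor_ind: t => [|c u v _ [n [a [b [g [-> gb]]]]]].
  by exists 0%N, (fun=> 0), (fun=> 0), (fun=> \0); rewrite big_ord0; split.
pose r i := g i (phi v) : k; pose v' := v - \sum_(i < n) r i *: b i.
pose a' i := a i + (c * r i) *: u.
have tE : c *: (u \ox v) + \sum_(i < n) a i \ox b i
    = \sum_(i < n) a' i \ox b i + (c *: u) \ox v'.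
  have vE : v = v' + \sum_(i < n) r i *: b i by rewrite subrK.
  rewrite -linearZl_LR {1}vE linearDr /= linear_sumr -addrA addrC.
  congr (_ + _); rewrite addrC -big_split; apply: eq_bigr => i _ /=.
  by rewrite linearDl /= linearZr_LR -linearZl_LR scalerA mulrC.
have gv' i : (i < n)%N -> g i (phi v') = 0 :> k.
  move=> ltin; rewrite !linearB !linear_sum /=.
  have gZ j : g i (phi (r j *: b j)) = r j * (g i (phi (b j)) : k) :> k.
    by rewrite !linearZ.
  rewrite (bigD1 (Ordinal ltin)) //= big1 => [|j ji].
    by rewrite gZ gb // eqxx mulr1 addr0 subrr.
  rewrite gZ gb; [|done|exact: ltn_ord].
  by rewrite eq_sym (negPf (ji : nat_of_ord j != i)) mulr0 oppr0.
have [v'0|v'n0] := eqVneq v' 0.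
  exists n, a', b, g; split; last exact: gb.
  by rewrite tE v'0 tens0r addr0.
have phi_v' : phi v' != 0.
  apply/eqP => e; move/eqP: v'n0; apply.
  by apply: phi_inj; rewrite e linear0.
have [f fv'] := functional_exists phi_v'.
pose f0 w : k := (f w : k) - \sum_(i < n) (f (phi (b i)) : k) * (g i w : k).
have [|f' f'E] := @linear_pack k W k^o f0.
  move=> d x y; rewrite /f0.
  have -> : \sum_(i < n) (f (phi (b i)) : k) * (g i (d *: x + y) : k)
      = d * (\sum_(i < n) (f (phi (b i)) : k) * (g i x : k))
        + \sum_(i < n) (f (phi (b i)) : k) * (g i y : k).
    rewrite mulr_sumr -big_split; apply: eq_bigr => i _ /=.
    by rewrite linearP /= mulrDr mulrCA.
  have -> : (f (d *: x + y) : k) = d * (f x : k) + (f y : k) by rewrite linearP.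
  by rewrite opprD addrACA -mulrBr.
have f'b i : (i < n)%N -> f' (phi (b i)) = 0 :> k.
  move=> ltin; rewrite f'E /f0 (bigD1 (Ordinal ltin)) //= big1 => [|j ji].
    by rewrite gb // eqxx mulr1 addr0 subrr.
  rewrite gb; [|exact: ltn_ord|done].
  by rewrite (negPf (ji : nat_of_ord j != i)) mulr0.
have f'v' : f' (phi v') = 1 :> k.
  rewrite f'E /f0 fv' big1 ?subr0 // => i _.
  by rewrite gv' ?ltn_ord // mulr0.
exists n.+1, (fun i => if i == n then c *: u else a' i),
  (fun i => if i == n then v' else b i), (fun i => if i == n then f' else g i).
split=> [|i j].
  rewrite tE big_ord_recr /= eqxx; congr (_ + _); apply: eq_bigr => i _.
  by rewrite (ltn_eqF (ltn_ord i)).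
have ltS l : (l < n.+1)%N -> l != n -> (l < n)%N.
  by rewrite ltnS [(l < n)%N]ltn_neqAle => -> ->.
move=> /ltS lti /ltS ltj; move: lti ltj.
have [->|ni] := eqVneq i n; have [->|nj] := eqVneq j n => lti ltj.
- by rewrite f'v'.
- by rewrite f'b ?ltj // eq_sym (negPf nj).
- by rewrite gv' ?lti // (negPf ni).
- by rewrite gb ?lti ?ltj.
Qed.
End Functionals.

Section Biorthogonal.
Variable k : fieldType.

Lemma sum_delta (V : lmodType k) n (i : nat) (v : nat -> V) : (i < n)%N ->
  \sum_(j < n) (i == j)%:R *: v j = v i.
Proof.
move=> ltin; rewrite (bigD1 (Ordinal ltin)) //= eqxx scale1r big1 ?addr0 //.
by move=> j ji; rewrite eq_sym (negPf (ji : nat_of_ord j != i)) scale0r.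
Qed.

Lemma slicer_exists (U V : lmodType k) (g : {linear V -> k^o}) :
  exists h : {linear tensor U V -> U}, forall u v, h (u \ox v) = (g v : k) *: u.
Proof. by apply: tensor_lift_exists; multilin. Qed.

Lemma slicel_exists (U V : lmodType k) (g : {linear U -> k^o}) :
  exists h : {linear tensor U V -> V}, forall u v, h (u \ox v) = (g u : k) *: v.
Proof. by apply: tensor_lift_exists; multilin. Qed.

(** Over a field, tensoring with an injective map is injective. *)
Lemma tensor_map_inj (U V W : lmodType k) (phi : {linear V -> W}) :
  injective phi -> forall t : tensor U V, tensor_map idfun phi t = 0 -> t = 0.
Proof.
move=> phi_inj t; have [n [a [b [g [-> gb]]]]] := tensor_biorthogonal t phi_inj.
move=> t0; rewrite big1 // => i _; have [h hE] := slicer_exists U (g i).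
have := congr1 h t0; rewrite linear0 !linear_sum => hi0.
suff -> : a i = 0 by rewrite linear0l.
rewrite -[RHS]hi0 -(@sum_delta _ n) //; apply: eq_bigr => j _.
by rewrite /= tensor_mapE hE gb.
Qed.

(** The left factors of a decomposition of [comul c] with biorthogonal right
    factors span a coideal: slicing [c1 (x) c2 (x) c3] in the third factor by
    [g i] computes [comul (w i)]. *)
Lemma right_coideal_exists (C : coalgType k) (c : C) :
  exists n (w : nat -> C),
    (exists e : nat -> k, c = \sum_(i < n) e i *: w i)
    /\ forall i, (i < n)%N -> exists T : nat -> C,
         comul (w i) = \sum_(j < n) w j \ox T j.
Proof.
have [n [a [b [g [cE gb]]]]] :=
  @tensor_biorthogonal _ _ _ _ idfun (comul c) (@inj_id C).
exists n, a; split.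
  exists (fun i => counit (b i)).
  rewrite -[LHS]counitr cE !linear_sum; apply: eq_bigr => i _.
  by rewrite /= tensor_mapE tensor_unitrE.
move=> i ltin; have [l lE] := slicer_exists C (g i).
have [q qE] : exists q : {linear tensor C (tensor C C) -> tensor C C},
    forall u t, q (u \ox t) = u \ox l t.
  by apply: tensor_lift_exists; multilin.
exists (fun j => l (comul (b j))).
have := congr1 q (comulA c); rewrite cE !linear_sum /=.
under [RHS]eq_bigr => j _ do rewrite tensor_mapE qE /=.
move=> <-; rewrite -(@sum_delta _ n i (fun j => comul (a j))) //.
apply: eq_bigr => j _.
rewrite tensor_mapE -gb // comul_cop cop_scale /= tens_copl !linear_cop.
apply: eq_cop => x y.
by rewrite /= tensor_assocE qE lE linearZr_LR.
Qed.

Lemma left_coideal_exists (C : coalgType k) (c : C) :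
  exists n (w : nat -> C),
    (exists e : nat -> k, c = \sum_(i < n) e i *: w i)
    /\ forall i, (i < n)%N -> exists T : nat -> C,
         comul (w i) = \sum_(j < n) T j \ox w j.
Proof.
(* Biorthogonality is needed on the left this time: exchange the factors. *)
have [s [sE s2]] : exists s : {linear tensor C C -> tensor C C},
    (forall u v, s (u \ox v) = v \ox u) /\ forall t, s (s t) = t.
  have [s sE] : exists s : {linear tensor C C -> tensor C C},
      forall u v, s (u \ox v) = v \ox u.
    by apply: tensor_lift_exists; multilin.
  exists s; split=> // t; elim/tensor_ind: t => [|a u v t IH].
    by rewrite !linear0.
  by rewrite !linearP IH !sE.
have [n [a [b [g [cE gb]]]]] :=
  @tensor_biorthogonal _ _ _ _ idfun (s (comul c)) (@inj_id C).
have {}cE : comul c = \sum_(i < n) b i \ox a i.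
  by rewrite -[LHS]s2 cE linear_sum; apply: eq_bigr => i _; apply: sE.
exists n, a; split.
  exists (fun i => counit (b i)).
  rewrite -[LHS]counitl cE !linear_sum; apply: eq_bigr => i _.
  by rewrite /= tensor_mapE tensor_unitlE.
move=> i ltin.
have [l lE] := slicel_exists C (g i).
have [q qE] := slicel_exists (tensor C C) (g i).
exists (fun j => l (comul (b j))).
have := congr1 q (comulA c); rewrite cE !linear_sum /=.
under [RHS]eq_bigr => j _ do rewrite tensor_mapE qE /=.
under [RHS]eq_bigr => j _ do rewrite gb //.
rewrite (@sum_delta _ n i (fun j => comul (a j))) // => <-.
apply: eq_bigr => j _.
rewrite tensor_mapE /= comul_cop tens_copl !linear_cop tens_copl.
apply: eq_cop => x y.
by rewrite /= tensor_assocE qE lE linearZl_LR.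
Qed.
End Biorthogonal.

(** * The right module [W (x) A] *)

Local Notation "t <* h" := (t * (1 \ox h)) (at level 40).

Section RightModules.
Variables (k : fieldType) (A : algType k).
Local Notation R := (tensor A A).

Lemma ract_tens a b h : (a \ox b) <* h = a \ox (b * h) :> R.
Proof. by rewrite tensor_mulE mulr1. Qed.

Lemma ract1 (t : R) : t <* 1 = t.
Proof. exact: mulr1. Qed.

Lemma ractA (t : R) g h : t <* g <* h = t <* (g * h).
Proof. by rewrite -mulrA ract_tens. Qed.

Lemma ractZ a (t : R) h : (a *: t) <* h = a *: (t <* h).
Proof.
by have := tensor_mulPl (1 \ox h) a t 0; rewrite !addr0 tensor_mul0l addr0.
Qed.

Lemma iter_ract (f : R -> R) m t h :
  (forall t h, f (t <* h) = f t <* h) -> iter m f (t <* h) = iter m f t <* h.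
Proof. by move=> fM; elim: m => //= m ->. Qed.

Definition rsubmod (U : set R) : Prop :=
  [/\ U 0, forall x y, U x -> U y -> U (x + y) & forall x h, U x -> U (x <* h)].

Definition rspan n (w : nat -> A) : set R :=
  [set t | exists h : nat -> A, t = \sum_(i < n) w i \ox h i].

Lemma rsubmodN U x : rsubmod U -> U x -> U (- x).
Proof.
move=> [_ _ UM] /(UM _ (-1)); congr U.
have -> : 1 \ox (- 1) = - 1 :> R by exact: linearNr.
exact: mulrN1.
Qed.

Lemma rspan_submod n w : rsubmod (rspan n w).
Proof.
split=> [|x y [f ->] [g ->]|x h [f ->]].
- by exists (fun=> 0); rewrite big1 // => i _; apply: linear0r.
- exists (fun i => f i + g i); rewrite -big_split; apply: eq_bigr => i _.
  by rewrite linearDr.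
- exists (fun i => f i * h); rewrite mulr_suml; apply: eq_bigr => i _.
  by rewrite ract_tens.
Qed.

Lemma rsubmod_sum U m (f : 'I_m -> R) :
  rsubmod U -> (forall i, U (f i)) -> U (\sum_i f i).
Proof. by move=> [U0 UD _] Uf; elim/big_ind: _. Qed.

Lemma rspan_tens n (w : nat -> A) a (e : nat -> k) h :
  a = \sum_(i < n) e i *: w i -> rspan n w (a \ox h).
Proof.
move=> ->; exists (fun i => e i *: h); rewrite linear_sumlz.
by apply: eq_bigr => i _; rewrite linearZr_LR linearZl_LR.
Qed.

(** Induction on the number of generators. A chain of submodules is controlled
    by the right ideals [I] of possible last coefficients and by the traces [V]
    on the span of the other generators. *)
Lemma acc_rspan n w : right_noetherian A ->
  acc (fun U => rsubmod U /\ U `<=` rspan n w).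
Proof.
move=> noeth; elim: n => [|n IHn] U UP Uinc.
  exists 0%N => m _; apply/seteqP; split=> x.
    by move=> /(UP m).2[h ->]; rewrite big_ord0; have [[]] := UP 0%N.
  by move=> /(UP 0%N).2[h ->]; rewrite big_ord0; have [[]] := UP m.
have Umono i j : (i <= j)%N -> U i `<=` U j.
  move=> leij; rewrite -(subnK leij); elim: (j - i)%N => [//|d IH].
  by apply: subset_trans IH _; rewrite addSn; apply: Uinc.
pose I m := [set h : A | exists2 z, rspan n w z & U m (z + w n \ox h)].
pose V m := U m `&` rspan n w.
have [N1 IN1] : exists N, forall m, (N <= m)%N -> I m = I N.
  apply: noeth => [m|m h [z zF zU]]; last by exists z => //; apply: Uinc.
  have [[U0 UD UM] _] := UP m; have [F0 FD FM] := rspan_submod n w.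
  split=> [|x y [z zF zU] [z' zF' zU']|a x [z zF zU]].
  - by exists 0 => //; rewrite linear0r addr0.
  - exists (z + z'); first exact: FD.
    by rewrite linearDr addrACA; apply: UD.
  - exists (z <* a); first exact: FM.
    by rewrite -ract_tens -mulrDl; apply: UM.
have [N2 VN2] : exists N, forall m, (N <= m)%N -> V m = V N.
  apply: IHn => [m|m x [Ux Fx]]; last by split=> //; apply: Uinc.
  have [[U0 UD UM] _] := UP m; have [F0 FD FM] := rspan_submod n w.
  split; last by move=> x [].
  split=> [//|x y [Ux Fx] [Uy Fy]|x h [Ux Fx]].
    by split; [apply: UD|apply: FD].
  by split; [apply: UM|apply: FM].
exists (maxn N1 N2) => m; rewrite geq_max => /andP[le1 le2].
have lem : (maxn N1 N2 <= m)%N by rewrite geq_max le1.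
apply/seteqP; split=> x; last exact: Umono.
move=> Ux; have [h xE] := (UP m).2 _ Ux; rewrite big_ord_recr /= in xE.
pose z := \sum_(i < n) w i \ox h i.
have : I N1 (h n) by rewrite -(IN1 m) //; exists z; [exists h|rewrite -xE].
move=> [z' z'F z'U].
have z'Um j : (N1 <= j)%N -> U j (z' + w n \ox h n).
  by move=> le1j; apply: Umono z'U.
have : V N2 (z - z').
  rewrite -(VN2 m) //; split.
    have -> : z - z' = x + - (z' + w n \ox h n).
      by rewrite xE opprD addrACA subrr addr0.
    have Um := (UP m).1; have [_ UD _] := Um.
    by apply: UD => //; apply: rsubmodN => //; apply: z'Um.
  have F := rspan_submod n w; have [_ FD _] := F.
  by apply: FD; [exists h|apply: rsubmodN].
move=> [zz' _]; have [_ UD _] := (UP (maxn N1 N2)).1.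
have -> : x = (z - z') + (z' + w n \ox h n) by rewrite addrA subrK.
apply: UD; last by apply: z'Um; apply: leq_maxl.
exact: Umono (leq_maxr _ _) _ zz'.
Qed.

(** A right [A]-linear endomorphism is determined by its values on the
    [a \ox 1], which may be prescribed. *)
Lemma rlinear_exists (f : A -> R) : linear f ->
  exists F : {linear R -> R}, (forall a h, F (a \ox h) = f a <* h)
    /\ forall t h, F (t <* h) = F t <* h.
Proof.
move=> /linear_pack[f' f'E].
have [|F FE] := @tensor_lift_exists _ _ _ _ (fun a h => f' a <* h).
  by multilin.
exists F; split=> [a h|t h]; first by rewrite FE f'E.
elim/tensor_ind: t => [|a u v t IH].
  by rewrite mul0r linear0 mul0r.
rewrite mulrDl ractZ ract_tens !linearP /= IH !FE mulrDl ractZ.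
by rewrite ractA.
Qed.
End RightModules.

(** * Injectivity of the antipode *)

Section Injectivity.
Variables (k : fieldType) (H : hopfAlgType k).
Local Notation R := (tensor H H).
Local Notation S := (@antipode k H).
Local Notation eps x := (@counit k H x : k).

Lemma eps_antipode x : eps (S x) = eps x.
Proof.
have := congr1 (@counit k H) (cop_antipodel x).
rewrite linear_cop linearZ /= eps1 [_ *: 1]mulr1 => <-.
rewrite -[LHS](@cop_counitr _ _ k^o (fun x => counit (S x))); last by multilin.
by apply: eq_cop => a b; rewrite [RHS]epsM [LHS]mulrC.
Qed.

Lemma cop_antipode (W : lmodType k) (f : H -> H -> W) x : bilin f ->
  cop (S x) f = \cop_(x => a, b) f (S b) (S a).
Proof.
move=> /tensor_lift_exists[g gE].
by rewrite -(lift_cop gE) comul_antipode linear_cop; apply: eq_cop => a b.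
Qed.

Lemma tensor_map_ract (u : H -> H) (f g : {linear H -> H}) (t : R) h :
  (forall a, g (a * h) = g a * u h) ->
  tensor_map f g (t <* h) = tensor_map f g t <* u h.
Proof.
move=> gM; elim/tensor_ind: t => [|a x y t IH].
  by rewrite mul0r linear0 mul0r.
rewrite mulrDl ractZ ract_tens !linearP /= IH !tensor_mapE gM mulrDl ractZ.
by rewrite ract_tens.
Qed.

Lemma tensor_map_cop (U V : lmodType k) (f : {linear H -> U})
    (g : {linear H -> V}) (F G : H -> H -> H) x :
  tensor_map f g (\cop_(x => a, b) (F a b \ox G a b))
  = \cop_(x => a, b) (f (F a b) \ox g (G a b)).
Proof. by rewrite linear_cop; apply: eq_cop => a b; rewrite /= tensor_mapE. Qed.

(** The map [x (x) h |-> x2 (x) x1 h] serves twice: [S (x) id] intertwines an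
    automorphism with it in the proof of injectivity, and its image detects
    denominators in the proof of surjectivity. *)
Lemma twist_exists : exists th : {linear R -> R},
  (forall a h, th (a \ox h) = (\cop_(a => b, c) (c \ox b)) <* h)
  /\ forall t h, th (t <* h) = th t <* h.
Proof.
by apply: (@rlinear_exists _ _ (fun a => \cop_(a => b, c) (c \ox b))); multilin.
Qed.

(** The automorphism [al] of [W (x) H], with inverse [be], preserves the kernel
    [P] of [S (x) id] because [S (x) id] intertwines [al] with [th]. The chain
    of the preimages of [P] under the powers of [al] shows that [be] preserves
    [P] as well. *)
Lemma antipode_inj : right_noetherian H -> injective S.
Proof.
move=> noeth.
have [th [thE thM]] := twist_exists.
have [|al [alE alM]] :=
    @rlinear_exists _ _ (fun a => \cop_(a => b, c) (b \ox S c)).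
  by multilin.
have [|be [beE beM]] := @rlinear_exists _ _ (@comul k H).
  by multilin.
have al_be t : al (be t) = t.
  elim/tensor_ind: t => [|a u v t IH]; first by rewrite !linear0.
  rewrite !linearP /= IH beE alM; congr (_ *: _ + _).
  rewrite -[v in RHS]mul1r -ract_tens; congr (_ <* _).
  rewrite comul_cop linear_cop.
  transitivity (\cop_(u => b, c) \cop_(b => d, e) (d \ox (S e * c))).
    apply: eq_cop => b c; rewrite /= alE cop_mulr.
    by apply: eq_cop => d e; rewrite ract_tens.
  rewrite (@copA _ _ _ _ (fun d e c => d \ox (S e * c))); last by multilin.
  rewrite -[RHS](@cop_counitr _ _ _ (fun u => u \ox (1 : H))); last by multilin.
  apply: eq_cop => b c.
  by rewrite -tens_copr cop_antipodel linearZr_LR.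
pose P : set R := [set t | tensor_map S idfun t = 0].
have alP t : P t -> P (al t).
  suff: tensor_map S idfun (al t) = th (tensor_map S idfun t).
    by rewrite /P /= => -> ->; rewrite linear0.
  elim/tensor_ind: t => [|a u v t IH]; first by rewrite !linear0.
  rewrite !linearP /= IH; congr (_ *: _ + _).
  rewrite alE tensor_mapE thE.
  rewrite (@tensor_map_ract id) //; congr (_ <* _).
  by rewrite tensor_map_cop cop_antipode //; multilin.
have PD s t : P s -> P t -> P (s + t).
  by rewrite /P /= linearD /= => -> ->; rewrite addr0.
have PM t h : P t -> P (t <* h).
  by rewrite /P /= (@tensor_map_ract id) // => ->; rewrite mul0r.
suff S0 x : S x = 0 -> x = 0.
  move=> x y Sxy; apply/eqP; rewrite -subr_eq0; apply/eqP/S0.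
  by rewrite linearB Sxy subrr.
move=> Sx0; have [n [w [[e xE] wE]]] := right_coideal_exists x.
have F_submod := rspan_submod n w; have [F0 FD FM] := F_submod.
have be_F t : rspan n w t -> rspan n w (be t).
  move=> [h ->]; rewrite linear_sum; apply: rsubmod_sum => // i.
  rewrite /= beE; apply: FM.
  by have [T ->] := wE i (ltn_ord i); exists T.
pose U m : set R := rspan n w `&` [set t | P (iter m al t)].
have [K UK] : exists K, forall m, (K <= m)%N -> U m = U K.
  apply: (@acc_rspan _ _ n w noeth) => [m|m t [Ft Pt]]; last first.
    by split=> //; apply: alP.
  split; last by move=> t [].
  split=> [|s t [Fs Ps] [Ft Pt]|t h [Ft Pt]].
  - by split=> //=; rewrite iter_linear0 /P /= linear0.
  - split; first exact: FD.
    by rewrite /= iter_linearD; apply: PD.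
  - split; first exact: FM.
    by rewrite /= iter_ract //; apply: PM.
have back t : rspan n w t -> P (al t) -> P t.
  move=> Ft Palt.
  have iK m : iter m al (iter m be t) = t.
    by elim: m => //= m IH; rewrite -iterS iterSr al_be.
  have : U K.+1 (iter K be t).
    split; last by rewrite /= iK.
    by elim: (K) => //= m IH; apply: be_F.
  by rewrite UK // => -[_ /=]; rewrite iK.
have Fx : rspan n w (x \ox 1) by apply: rspan_tens xE.
have Pdx : P (be (x \ox 1)).
  apply: back; first exact: be_F.
  by rewrite al_be /P /= tensor_mapE Sx0 linear0l.
move: Pdx; rewrite /P /= beE ract1 => dx0.
have := congr1 (fun t => tensor_unitl (tensor_map (@counit k H) idfun t)) dx0.
rewrite !linear0 comul_cop tensor_map_cop tensor_map_cop linear_cop => <-.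
rewrite -[LHS](@cop_counitl _ _ _ (fun x => x)) //.
by apply: eq_cop => a b /=; rewrite tensor_unitlE eps_antipode.
Qed.
End Injectivity.

(** * Surjectivity of the antipode *)

Section Surjectivity.
Variables (k : fieldType) (H : hopfAlgType k).
Local Notation R := (tensor H H).
Local Notation S := (@antipode k H).
Local Notation eps x := (@counit k H x : k).

Lemma antipode2_exists : exists S2 : {linear H -> H}, forall x, S2 x = S (S x).
Proof. by apply: (@linear_pack _ _ _ (fun x => S (S x))); multilin. Qed.

(** After [id (x) S^2], the map [et] is a left inverse of [th]: the product
    [S(S(a1) a2)] appears in the second factor. Without [S^2] the factors come
    in the wrong order, and an inverse of [S] would be called for. *)
Lemma untwist_twist (S2 th et : {linear _ -> _}) :
  (forall x, S2 x = S (S x)) ->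
  (forall a h, th (a \ox h) = (\cop_(a => b, c) (c \ox b)) <* h) ->
  (forall a h, et (a \ox h) = (\cop_(a => b, c) (c \ox S b)) <* h) ->
  forall t : R, et (tensor_map idfun S2 (th t)) = tensor_map idfun S2 t :> R.
Proof.
move=> S2E thE etE; elim/tensor_ind=> [|a u v t IH]; first by rewrite !linear0.
rewrite !linearP /= IH thE (@tensor_map_ract _ _ S2); last first.
  by move=> x; rewrite !S2E !antipodeM.
rewrite tensor_map_cop tensor_mapE /= cop_mulr linear_cop; congr (_ *: _ + _).
transitivity (\cop_(u => b, c) \cop_(c => d, e) (e \ox (S d * S2 b * S2 v))).
  apply: eq_cop => b c; rewrite ract_tens /= etE cop_mulr.
  by apply: eq_cop => d e; rewrite ract_tens mulrA.
rewrite -(@copA _ _ _ _ (fun b d e => e \ox (S d * S2 b * S2 v)));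
  last by multilin.
rewrite -[RHS](@cop_counitl _ _ _ (fun u => u \ox S2 v)); last by multilin.
apply: eq_cop => b c; rewrite -tens_copr -cop_mulr.
have -> : \cop_(b => d, e) (S e * S2 d) = eps b *: 1.
  rewrite -[1](@antipode1 k H) -linearZ /= -cop_antipodel linear_cop.
  by apply: eq_cop => d e; rewrite S2E /= antipodeM.
by rewrite -scalerAl mul1r linearZr_LR.
Qed.

(** If [y] is as below and [S] is bijective then [S^-1 c * s = y], so [s] is a
    denominator of [S^-1 c]; applying [S^2] keeps the condition inside [H]. *)
Definition denominator (c s : H) : Prop := exists y, S c * S (S s) = S (S y).

Lemma denominator_mulr c s h : denominator c s -> denominator c (s * h).
Proof. by move=> [y E]; exists (y * h); rewrite !antipodeM mulrA E. Qed.

Lemma denominator_add c s t :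
  denominator c s -> denominator c t -> denominator c (s + t).
Proof.
move=> [x Ex] [y Ey]; exists (x + y).
by rewrite !linearD mulrDr /= Ex Ey.
Qed.

Lemma tens_neq0 (U V : lmodType k) (a : U) (b : V) :
  a != 0 -> b != 0 -> a \ox b != 0.
Proof.
move=> /functional_exists[g g1] b0; apply: contra_neq b0 => ab0.
have [h hE] := slicel_exists V g.
by have := hE a b; rewrite ab0 linear0 g1 scale1r.
Qed.

(** The submodules [U m], generated by the [th^j (c (x) g)] for [j < m], form a
    chain in [W (x) H]. When it becomes stationary there is a relation between
    these elements, and its first nonzero term, divided by a power of the
    injective map [th], is a nonzero multiple of [c (x) g] in the image of
    [th]. *)
Lemma denominator_essential c g : right_noetherian H -> injective S ->
  g != 0 -> exists2 h, g * h != 0 & denominator c (g * h).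
Proof.
move=> noeth S_inj g0.
have [->|c0] := eqVneq c 0.
  by exists 1; rewrite mulr1 //; exists 0; rewrite !linear0 mul0r.
have [S2 S2E] := antipode2_exists.
have [th [thE thM]] := twist_exists H.
have [|et [etE _]] :=
    @rlinear_exists _ H (fun a => \cop_(a => b, c) (c \ox S b)).
  by multilin.
have et_th := untwist_twist S2E thE etE.
have S2_inj : injective S2 by move=> x y; rewrite !S2E => /S_inj/S_inj.
have th_inj t : th t = 0 -> t = 0.
  move=> tht; apply: (tensor_map_inj S2_inj).
  by rewrite -et_th tht !linear0.
pose z0 := c \ox g : R.
have z0n0 : z0 != 0 by apply: tens_neq0.
suff [h zh0 [z zhE]] : exists2 h, z0 <* h != 0 & exists z, z0 <* h = th z.
  rewrite ract_tens in zh0 zhE; exists h.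
    by apply: contra_neq zh0 => ->; apply: tens0r.
  have [l lE] := slicel_exists H (@counit k H).
  have lS2 t : l (tensor_map idfun S2 t) = S2 (l t).
    elim/tensor_ind: t => [|a u v t IH]; first by rewrite !linear0.
    by rewrite !linearP /= IH tensor_mapE !lE [S2 (_ *: v)]linearZ.
  exists (l z); have := congr1 (fun t => l (et (tensor_map idfun S2 t))) zhE.
  rewrite et_th lS2 tensor_mapE /= etE cop_mulr linear_cop !S2E => <-.
  rewrite -[LHS](@cop_counitr _ _ _ (fun c => S c * S (S (g * h))));
    last by multilin.
  by apply: eq_cop => a b; rewrite ract_tens /= lE.
have shift_relation m (f : nat -> H) :
    iter m th z0 = \sum_(j < m) iter j th (z0 <* f j) ->
    exists2 h, z0 <* h != 0 & exists z, z0 <* h = th z.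
  elim: m f => [f|m IH f].
    by rewrite big_ord0 => /= z00; rewrite z00 eqxx in z0n0.
  rewrite big_ord_recl /= => E.
  have {}E : z0 <* f 0%N
      = th (iter m th z0 - \sum_(j < m) iter j th (z0 <* f j.+1)).
    rewrite linearB /= E linear_sum /=; apply/eqP; rewrite eq_sym subr_eq.
    by apply/eqP; congr (_ + _); apply: eq_bigr => j _; rewrite /bump leq0n.
  have [z00|z0f] := eqVneq (z0 <* f 0%N) 0; last first.
    by exists (f 0%N) => //; eexists; apply: E.
  apply: (IH (fun j => f j.+1)); apply/eqP; rewrite -subr_eq0; apply/eqP.
  by apply: th_inj; rewrite -E.
have [n [w [[e cE] wE]]] := left_coideal_exists c.
have F_submod := rspan_submod n w; have [F0 FD FM] := F_submod.
have th_F t : rspan n w t -> rspan n w (th t).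
  move=> [h ->]; rewrite linear_sum; apply: rsubmod_sum => // i.
  rewrite /= thE; apply: FM.
  have [s sE] : exists s : {linear R -> R}, forall u v, s (u \ox v) = v \ox u.
    by apply: tensor_lift_exists; multilin.
  have <- : s (comul (w i)) = \cop_(w i => b, c) (c \ox b).
    by apply: lift_cop => a b; apply: sE.
  have [T ->] := wE i (ltn_ord i).
  by rewrite linear_sum; exists T; apply: eq_bigr => j _; apply: sE.
have Fz0 : rspan n w z0 by apply: rspan_tens cE.
have Fiter j t : rspan n w t -> rspan n w (iter j th t).
  by move=> Ft; elim: j => //= j; apply: th_F.
pose U m : set R :=
  [set t | exists f : nat -> H, t = \sum_(j < m) iter j th (z0 <* f j)].
have ract0 t : t <* 0 = 0 :> R by rewrite linear0r mulr0.
have [K UK] : exists K, forall m, (K <= m)%N -> U m = U K.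
  apply: (@acc_rspan _ _ n w noeth) => [m|m t [f tE]]; last first.
    exists (fun j => if (j < m)%N then f j else 0).
    rewrite big_ord_recr /= ltnn ract0 iter_linear0 addr0 tE.
    by apply: eq_bigr => j _; rewrite ltn_ord.
  split; last first.
    by move=> t [f ->]; apply: rsubmod_sum => // j; apply: Fiter; apply: FM.
  split=> [|s t [f ->] [f' ->]|t h [f ->]].
  - by exists (fun=> 0); rewrite big1 // => j _; rewrite ract0 iter_linear0.
  - exists (fun j => f j + f' j); rewrite -big_split; apply: eq_bigr => j _.
    by rewrite linearDr mulrDr iter_linearD.
  - exists (fun j => f j * h); rewrite mulr_suml; apply: eq_bigr => j _.
    by rewrite -ractA [RHS]iter_ract.
have : U K.+1 (iter K th z0).
  exists (fun j => if j == K then 1 else 0); rewrite big_ord_recr /= eqxx ract1.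
  rewrite big1 ?add0r // => j _.
  by rewrite (ltn_eqF (ltn_ord j)) ract0 iter_linear0.
by rewrite UK // => -[f]; apply: shift_relation.
Qed.

Lemma denominator_common n (w : nat -> H) : right_noetherian H -> injective S ->
  exists2 s, s != 0 & forall i, (i < n)%N -> denominator (w i) s.
Proof.
move=> noeth S_inj; elim: n => [|n [s s0 sw]].
  by exists 1; rewrite ?oner_eq0.
have [h sh0 shw] := denominator_essential (w n) noeth S_inj s0.
exists (s * h) => // i; rewrite ltnS leq_eqVlt => /predU1P[->//|/sw].
exact: denominator_mulr.
Qed.

(** Slicing the identity [key] in the second factor by [g]: the left-hand side
    is in [S^2 H (x) H] because each [S(w j) S^2(s)] is in [S^2 H]. *)
Lemma denominator_slice n (w : nat -> H) (s : H) (g : {linear H -> k^o}) :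
  (forall i, (i < n)%N ->
     exists T : nat -> H, comul (w i) = \sum_(j < n) T j \ox w j) ->
  (forall i, (i < n)%N -> denominator (w i) s) ->
  forall i, (i < n)%N ->
    denominator (w i) (\cop_(s => a, b) ((g (S (S b)) : k) *: a)).
Proof.
move=> wE ws i ltin; have [S2 S2E] := antipode2_exists.
have [T TE] := wE i ltin.
have [y yE] : {y : nat -> H & forall j, (j < n)%N -> S (w j) * S2 s = S2 (y j)}.
  have dec j : {y | (j < n)%N -> S (w j) * S2 s = S2 y}.
    apply: cid; have [/ws[y E]|_] := boolP (j < n)%N; last by exists 0.
    by exists y => _; rewrite !S2E.
  by exists (fun j => sval (dec j)) => j; apply: (svalP (dec j)).
have comulS2 x : comul (S2 x) = tensor_map S2 S2 (comul x).
  rewrite S2E comul_antipode cop_antipode; last by multilin.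
  rewrite [in RHS]comul_cop tensor_map_cop.
  by apply: eq_cop => a b; rewrite !S2E.
have key : \sum_(j < n) (1 \ox T j) * comul (S2 (y j))
    = \cop_(s => a, b) ((S (w i) * S2 a) \ox S2 b).
  transitivity ((S (w i) \ox 1) * comul (S2 s)); last first.
    rewrite comulS2 [in LHS]comul_cop tensor_map_cop cop_mull.
    by apply: eq_cop => a b; rewrite tensor_mulE mul1r.
  have -> : S (w i) \ox 1 = \sum_(j < n) (1 \ox T j) * comul (S (w j)) :> R.
    pose F u v : R := \cop_(v => c, d) (S d \ox (u * S c)).
    have [|l lE] := @tensor_lift_exists _ H H R F.
      by rewrite /F; multilin.
    transitivity (l (comul (w i))); last first.
      rewrite TE linear_sum; apply: eq_bigr => j _; rewrite /= lE /F.
      rewrite comul_antipode cop_mull; apply: eq_cop => c d.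
      by rewrite tensor_mulE mul1r.
    rewrite (lift_cop lE) /F.
    rewrite -(@copA _ _ _ _ (fun u c d => S d \ox (u * S c)));
      last by multilin.
    rewrite -[LHS](@cop_counitl _ _ _ (fun x => S x \ox (1 : H)));
      last by multilin.
    by apply: eq_cop => a b; rewrite -tens_copr cop_antipoder linearZr_LR.
  rewrite mulr_suml; apply: eq_bigr => j _.
  by rewrite -mulrA -comulM yE.
have [l lE] := slicer_exists H g.
exists (\sum_(j < n) \cop_(y j => a, b) ((g (T j * S2 b) : k) *: a)).
have E := congr1 l key; rewrite linear_cop linear_sum /= in E.
rewrite -!S2E linear_cop cop_mull.
transitivity (\cop_(s => a, b) l ((S (w i) * S2 a) \ox S2 b)).
  by apply: eq_cop => a b; rewrite lE -S2E linearZ /= -scalerAr S2E.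
rewrite -E linear_sum; apply: eq_bigr => j _.
rewrite comulS2 comul_cop tensor_map_cop cop_mull !linear_cop.
by apply: eq_cop => a b; rewrite /= tensor_mulE mul1r lE linearZ.
Qed.

Lemma antipode_surj : right_noetherian H -> injective S ->
  forall c, exists x, c = S x.
Proof.
move=> noeth S_inj c.
have [S2 S2E] := antipode2_exists.
have S2_inj : injective S2 by move=> x y; rewrite !S2E => /S_inj/S_inj.
have [n [w [[e cE] wE]]] := left_coideal_exists c.
have [s s0 sw] := denominator_common n w noeth S_inj.
have [s' s'w eps_s'] :
    exists2 s', (forall i, (i < n)%N -> denominator (w i) s') & eps s' = 1.
  have S2s0 : S2 s != 0.
    by apply: contra_neq s0 => S2s0; apply: S2_inj; rewrite linear0.
  have [g gs] := functional_exists S2s0.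
  exists (\cop_(s => a, b) ((g (S (S b)) : k) *: a)).
    exact: denominator_slice wE sw.
  rewrite linear_cop -gs -[RHS](@cop_counitl _ _ k^o (fun s => g (S2 s)));
    last by multilin.
  by apply: eq_cop => a b; rewrite linearZ /= -S2E; apply: mulrC.
(* Each [a j] is a translate of [s'], by the functional dual to [S2 (b j)]. *)
have [m [a [b [g [s'E gb]]]]] := tensor_biorthogonal (comul s') S2_inj.
have aw j : (j < m)%N -> forall i, (i < n)%N -> denominator (w i) (a j).
  move=> ltjm i ltin.
  have -> : a j = \cop_(s' => x, y) ((g j (S (S y)) : k) *: x).
    have [|l lE] :=
        @tensor_lift_exists _ H H _ (fun x y => (g j (S2 y) : k) *: x).
      by multilin.
    transitivity (l (comul s')).
      rewrite s'E linear_sum -(@sum_delta _ _ m j a) //; apply: eq_bigr => i' _.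
      by rewrite /= lE gb.
    by rewrite (lift_cop lE); apply: eq_cop => x y; rewrite S2E.
  exact: denominator_slice wE s'w _ _.
have one_denominator i : (i < n)%N -> denominator (w i) 1.
  move=> ltin.
  have -> : 1 = \sum_(j < m) a j * S (b j).
    rewrite -[LHS]scale1r -eps_s' -antipoder s'E !linear_sum.
    by apply: eq_bigr => j _; rewrite /= tensor_mapE tensor_mulmapE.
  elim/big_ind: _ => [|x y ? ?|j _].
  - by exists 0; rewrite !linear0 mulr0.
  - exact: denominator_add.
  - by apply: denominator_mulr; apply: aw.
have wS i : exists x, (i < n)%N -> w i = S x.
  have [ltin|_] := boolP (i < n)%N; last by exists 0.
  have [y E] := one_denominator i ltin; exists y => _; apply: S_inj.
  by rewrite -E !antipode1 mulr1.
exists (\sum_(i < n) e i *: sval (cid (wS i))).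
rewrite cE linear_sum; apply: eq_bigr => i _.
by rewrite linearZ /= -(svalP (cid (wS i))).
Qed.

Lemma antipode_bij : right_noetherian H -> bijective S.
Proof.
move=> noeth; have S_inj := antipode_inj noeth.
have S_surj c := cid (antipode_surj noeth S_inj c).
exists (fun c => sval (S_surj c)) => x; last by rewrite -(svalP (S_surj x)).
by apply: S_inj; rewrite -(svalP (S_surj (S x))).
Qed.

End Surjectivity.

(** * The opposite-coopposite Hopf algebra *)

(** An alias, so that the reversed structures do not compete with the
    original ones on [H]. *)
Definition opcop (H : Type) : Type := H.

Section OpCop.
Variables (k : fieldType) (H : hopfAlgType k).
Local Notation O := (opcop H).

HB.instance Definition _ := GRing.NzRing.copy O (H^c).

Fact opcop_scaleA (a b : k) (x : O) : a *: (b *: (x : H)) = (a * b) *: (x : H).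
Proof. exact: scalerA. Qed.
HB.instance Definition _ := GRing.Zmodule_isLmodule.Build k O
  opcop_scaleA (@scale1r k H) (@scalerDr k H) (@scalerDl k H).

Fact opcop_scaleAl (a : k) (x y : O) : a *: (x * y) = (a *: x) * y.
Proof. exact: (@scalerAr k H a y x). Qed.
HB.instance Definition _ := GRing.Lmodule_isLalgebra.Build k O opcop_scaleAl.
Fact opcop_scaleAr (a : k) (x y : O) : a *: (x * y) = x * (a *: y).
Proof. exact: (@scalerAl k H a y x). Qed.
HB.instance Definition _ := GRing.Lalgebra_isAlgebra.Build k O opcop_scaleAr.

Definition opcop_comul (x : O) : tensor O O :=
  \cop_((x : H) => a, b) ((b : O) \ox (a : O)).
Fact opcop_comul_linear : linear opcop_comul.
Proof. by rewrite /opcop_comul; multilin. Qed.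
Fact opcop_counit_linear : linear (@counit k H : O -> k^o).
Proof. by move=> a x y; apply: (@linearP k H _ _ (@counit k H) a x y). Qed.
Fact opcop_antipode_linear : linear (@antipode k H : O -> O).
Proof. by move=> a x y; apply: (@linearP k H _ _ (@antipode k H) a x y). Qed.

HB.instance Definition _ :=
  GRing.isLinear.Build k O (tensor O O) *:%R opcop_comul opcop_comul_linear.
Definition opcop_counit : O -> k^o := @counit k H.
HB.instance Definition _ :=
  GRing.isLinear.Build k O k^o *:%R opcop_counit opcop_counit_linear.
Definition opcop_antipode : O -> O := @antipode k H.
HB.instance Definition _ :=
  GRing.isLinear.Build k O O *:%R opcop_antipode opcop_antipode_linear.

Fact opcop_comulA (c : O) :
  tensor_assoc (tensor_map opcop_comul idfun (opcop_comul c))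
  = tensor_map idfun opcop_comul (opcop_comul c).
Proof.
rewrite /opcop_comul !linear_cop.
pose F (d e b : H) : tensor O (tensor O O) :=
  (b : O) \ox ((e : O) \ox (d : O)).
transitivity (\cop_((c : H) => a, b) \cop_(b => d, e) F a d e).
  apply: eq_cop => a b; rewrite /= tensor_mapE /= tens_copl linear_cop.
  by apply: eq_cop => d e; rewrite /= tensor_assocE.
rewrite -(@copA _ _ _ _ F); last by rewrite /F; multilin.
by apply: eq_cop => a b; rewrite /= tensor_mapE /= tens_copr.
Qed.

Fact opcop_counitl (c : O) :
  tensor_unitl (tensor_map opcop_counit idfun (opcop_comul c)) = c.
Proof.
rewrite /opcop_comul !linear_cop -[RHS](@cop_counitr _ _ H idfun) //.
by apply: eq_cop => a b; rewrite /= tensor_mapE tensor_unitlE.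
Qed.

Fact opcop_counitr (c : O) :
  tensor_unitr (tensor_map idfun opcop_counit (opcop_comul c)) = c.
Proof.
rewrite /opcop_comul !linear_cop -[RHS](@cop_counitl _ _ H idfun) //.
by apply: eq_cop => a b; rewrite /= tensor_mapE tensor_unitrE.
Qed.
HB.instance Definition _ :=
  isCoalgebra.Build k O opcop_comulA opcop_counitl opcop_counitr.

Fact opcop_comul_monoid_morphism : monoid_morphism opcop_comul.
Proof.
split=> [|x y]; rewrite /opcop_comul.
  by rewrite cop1 //; multilin.
rewrite (@cop_mul _ _ _ (fun a b : H => (b : O) \ox (a : O)) y x);
  last by multilin.
rewrite cop_mulr exchange_cop; apply: eq_cop => a b.
by rewrite cop_mull; apply: eq_cop => c d; rewrite tensor_mulE.
Qed.

Fact opcop_counit_monoid_morphism : monoid_morphism opcop_counit.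
Proof.
split=> [|x y]; first exact: (@eps1 k H).
by rewrite /opcop_counit [LHS](@epsM k H y x); apply: mulrC.
Qed.
HB.instance Definition _ := isBialgebra.Build k O
  opcop_comul_monoid_morphism opcop_counit_monoid_morphism.

Fact opcop_antipodel (h : O) :
  tensor_mulmap (tensor_map opcop_antipode idfun (opcop_comul h))
  = (opcop_counit h : k)%:A.
Proof.
rewrite /opcop_comul !linear_cop [RHS](esym (@cop_antipoder k H h)).
by apply: eq_cop => a b; rewrite /= tensor_mapE tensor_mulmapE.
Qed.

Fact opcop_antipoder (h : O) :
  tensor_mulmap (tensor_map idfun opcop_antipode (opcop_comul h))
  = (opcop_counit h : k)%:A.
Proof.
rewrite /opcop_comul !linear_cop [RHS](esym (@cop_antipodel k H h)).
by apply: eq_cop => a b; rewrite /= tensor_mapE tensor_mulmapE.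
Qed.
HB.instance Definition _ :=
  isHopfAlgebra.Build k O opcop_antipodel opcop_antipoder.

Lemma opcop_noetherian : left_noetherian H -> right_noetherian O.
Proof. by []. Qed.

End OpCop.

(** * Transport of the chain conditions *)

Lemma left_ideal_preimage (k : fieldType) (H : hopfAlgType k) (I : set H) :
  left_ideal I -> right_ideal (@antipode k H @^-1` I).
Proof.
move=> [I0 ID IM]; split=> [|x y|a x]; rewrite /preimage /=.
- by rewrite linear0.
- by rewrite linearD; apply: ID.
- by rewrite antipodeM; apply: IM.
Qed.

Lemma right_ideal_preimage (k : fieldType) (H : hopfAlgType k) (I : set H) :
  right_ideal I -> left_ideal (@antipode k H @^-1` I).
Proof.
move=> [I0 ID IM]; split=> [|x y|a x]; rewrite /preimage /=.
- by rewrite linear0.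
- by rewrite linearD; apply: ID.
- by rewrite antipodeM; apply: IM.
Qed.

Lemma acc_preimage (T : Type) (f : T -> T) (P Q : set T -> Prop) :
  bijective f -> (forall I, P I -> Q (f @^-1` I)) -> acc Q -> acc P.
Proof.
move=> [g fK gK] PQ accQ I IP Iinc.
have [N IN] := accQ (fun n => f @^-1` I n) (fun n => PQ _ (IP n))
  (fun n x => Iinc n (f x)).
exists N => n /IN E; apply/seteqP; split=> x Ix.
  by have := congr1 (@^~ (g x)) E; rewrite /preimage /= gK => <-.
by have := congr1 (@^~ (g x)) E; rewrite /preimage /= gK => ->.
Qed.

Theorem theorem4p3 (k : fieldType) (H : hopfAlgType k) :
  residually_finite_dim H ->
  right_noetherian H \/ left_noetherian H ->
  bijective (@antipode k H) /\ (right_noetherian H /\ left_noetherian H).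
Proof.
move=> _ noeth.
have S_bij : bijective (@antipode k H).
  by case: noeth => [/antipode_bij//|/opcop_noetherian/antipode_bij].
split=> //; case: noeth => noeth; split=> //; apply: acc_preimage S_bij _ noeth.
  exact: left_ideal_preimage.
exact: right_ideal_preimage.
Qed.
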